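(* Let $\mathbf{P}\subset\mathbb{C}$ be a Jordan arc and let $(A,b)\in C_{n,n}(\mathbf{P})\times C_n(\mathbf{P})$ satisfy the following three conditions. (N1) The pair $(A(\theta),b(\theta))$ is reachable for every $\theta\in\mathbf{P}$. (N2) $\sigma(A(\theta))\cap\sigma(A(\theta'))=\emptyset$ for any pair of distinct parameters $\theta,\theta'\in\mathbf{P}$. (S2) $A(\theta)$ has simple eigenvalues for each $\theta\in\mathbf{P}$. Let $\lambda_1,\dots,\lambda_n$ be the distinct (continuous, injective) eigenvalue functions of $A$, and let $S(\theta)$ be the continuous invertible change of coordinates with $$S(\theta)^{-1}A(\theta)S(\theta)=\operatorname{diag}(\lambda_1(\theta),\dots,\lambda_n(\theta)),\qquad S(\theta)^{-1}b(\theta)=(1,\dots,1)^{\top}.$$ Let $\varepsilon>0$, suppose that $f\in C_n(\mathbf{P})$ is such that $(S^{-1}f)_k\circ\lambda_k^{-1}\in\operatorname{Lip}(\lambda_k(\mathbf{P}))$ for all $k=1,\dots,n$, and assume that $\lambda_k(\mathbf{P})=[\underline a_k,\overline a_k]$, $k=1,\dots,n$, are compact real intervals. Write $g_k:=(S^{-1}f)_k\circ\lambda_k^{-1}$, let $L_k>0$ be a Lipschitz constant of $g_k$, let $M_{g_k}=\max_{z\in\lambda_k(\mathbf{P})}|g_k(z)|$, and let $B_{g_k,n_k}$ be the Bernstein polynomial of $g_k$ on $[\underline a_k,\overline a_k]$ of degree $n_k\ge3$, where $n_k$ satisfies $$\sqrt2\left(4M_{g_k}+\frac{(\overline a_k-\underline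 a_k)L_k}{2}\right)\sqrt{\frac{\log n_k}{n_k}}<\frac{\varepsilon}{3\|S\|_{M,\infty}}.$$ Put $\alpha_{k,l}=\sup_{\theta\in\mathbf{P}}|B_{g_l,n_l}(\lambda_k(\theta))|$. Let $\lambda(\mathbf{P})=\bigcup_{k=1}^n\lambda_k(\mathbf{P})$, let $h_j\colon\lambda(\mathbf{P})\to\mathbb{C}$ be the indicator function of $\lambda_j(\mathbf{P})$, and let $q_1,\dots,q_n$ be polynomials, obtained by applying Runge's little theorem to $h_1,\dots,h_n$, such that for all $j,k\in\{1,\dots,n\}$ $$\sup_{z\in\lambda_k(\mathbf{P})}|q_j(z)-h_j(z)|<\frac{\varepsilon}{3\|S\|_{M,\infty}\sum_{l=1}^n\alpha_{k,l}}.$$ Let $$p(z)=\sum_{k=1}^nq_k(z)\,B_{g_k,n_k}(z)=\sum_{l=0}^N\beta_lz^l$$ be the monomial representation. Then, for $$T=N+1\qquad\text{and}\qquad u=(u_0,\dots,u_{T-1})=(\beta_N,\dots,\beta_0),$$ the solution of the discrete-time system $x_{t+1}(\theta)=A(\theta)x_t(\theta)+b(\theta)u_t$, $x_0(\theta)=0$, satisfies $$\|\varphi(T,u,0)-f\|_\infty<\varepsilon.$$ In particular, the result is true if $(A,b)\in C^1_{n,n}(\mathbf{P})\times C^1_n(\mathbf{P})$ and $f\in\operatorname{Lip}_n(\mathbf{P})$.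
   Context: A Jordan arc is a homeomorphic image in $\mathbb{C}$ of a compact interval. $C_{n,m}(\mathbf{P})$ and $C_n(\mathbf{P})$ denote the continuous functions from $\mathbf{P}$ to $\mathbb{C}^{n\times m}$ and $\mathbb{C}^n$; a superscript $1$ denotes the continuously differentiable ones. $\operatorname{Lip}_n(\Omega)$ is the set of functions $g\colon\Omega\to\mathbb{C}^n$ for which there is $L>0$ (a Lipschitz constant) with $\|g(z_1)-g(z_2)\|\le L|z_1-z_2|$ for all $z_1,z_2\in\Omega$, and $\operatorname{Lip}=\operatorname{Lip}_1$. $\sigma(\cdot)$ is the spectrum. A pair $(A,b)\in\mathbb{C}^{n\times n}\times\mathbb{C}^n$ is reachable if $b,Ab,\dots,A^{n-1}b$ are linearly independent. The conditions (N1), (N2), (S2) ensure that the $\lambda_k$ are injective with pairwise disjoint images and that $S$ exists. $\|\cdot\|$ is the norm on $\mathbb{C}^n$, $\|g\|_\infty=\sup_{\theta\in\mathbf{P}}\|g(\theta)\|$, $\|\cdot\|_M$ is a matrix norm that is submultiplicative to $\|\cdot\|$, i.e. $\|Xv\|\le\|X\|_M\|v\|$, and $\|S\|_{M,\infty}=\sup_{\theta\in\mathbf{P}}\|S(\theta)\|_M$. $(S^{-1}f)_k$ denotes the $k$-th component of $\theta\mapsto S(\theta)^{-1}f(\theta)$. The inputs $u_t\in\mathbb{C}$ do not depend on $\theta$, and the solution at time $T$ is $\varphi(T,u,0)(\theta)=\sum_{k=0}^{T-1}A(\theta)^{T-1-k}b(\theta)u_k$. The $m$-th Bernstein polynomial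 of $g\colon[\underline a,\overline a]\to\mathbb{C}$ is $$B_{g,m}(x)=\frac{1}{(\overline a-\underline a)^m}\sum_{j=0}^m\binom{m}{j}\,g\big(\underline a+\tfrac jm(\overline a-\underline a)\big)(x-\underline a)^j(\overline a-x)^{m-j}.$$
   Formalization: The norm on C^n is the maximum norm (the claim fails e.g. for the Euclidean norm, n ≥ 10). In the C^1 case g_k is shown to be Lipschitz only if λ_k' has no zero on P (A(t)=t^3, b=1, f(t)=t on [-1,1] is a counterexample otherwise); the result itself is stated for given Lipschitz constants L_k. *)

(* Defs.v *)
From HB Require Import structures.
From mathcomp Require Import all_boot all_order all_algebra.
From mathcomp Require Import all_classical all_reals all_analysis.
From mathcomp Require Import complex.
Set Implicit Arguments.
Unset Strict Implicit.
Unset Printing Implicit Defensive.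
Import Order.TTheory GRing.Theory Num.Theory.
Import numFieldNormedType.Exports.
Local Open Scope classical_set_scope.
Local Open Scope ring_scope.
Local Open Scope complex_scope.

(* Seen through numClosedFieldType, R[i] inherits the normed-space topology of
   an arbitrary numeric field; R[i] itself carries no topology. *)
Definition cplx (R : realType) : numClosedFieldType := R[i].

(* Norms of spaces over R[i] take their values in R[i] (nonnegative reals);
   [rnorm] is the same number as an element of R.  On 'cV_n it is the maximum
   norm \max_k `|v k 0|. *)
Definition rnorm (R : realType) (V : normedZmodType (cplx R)) (v : V) : R :=
  complex.Re `|v|.

Definition supnorm (R : realType) (T : Type) (V : normedZmodType (cplx R))
    (D : set T) (h : T -> V) : R :=
  sup [set rnorm (h x) | x in D].

(* Nonnegativity of N follows from these axioms. *)
Definition is_norm (R : realType) (V : lmodType (cplx R)) (N : V -> R) : Prop :=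
  [/\ forall v, N v = 0 -> v = 0,
      forall (a : cplx R) v, N (a *: v) = rnorm a * N v
    & forall v w, N (v + w) <= N v + N w].

Definition jordan_arc (R : realType) (P : set (cplx R)) : Prop :=
  exists (a b : R) (gam : R -> cplx R) (del : cplx R -> R),
    [/\ a < b,
        {within `[a, b], continuous gam},
        gam @` `[a, b] = P,
        {in `[a, b], cancel gam del}
      & {within P, continuous del}].

Definition lip_on (R : realType) (V : normedModType (cplx R))
    (D : set (cplx R)) (h : cplx R -> V) : Prop :=
  exists2 L : R, 0 < L & L%:C.-lipschitz_D h.

(* Complex derivative relative to P: the difference quotient is only taken
   along points of P. *)
Definition derive_within (R : realType) (V : normedModType (cplx R))
    (P : set (cplx R)) (h : cplx R -> V) (t : cplx R) (d : V) : Prop :=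
  (fun z => (z - t)^-1 *: (h z - h t)) @ within P t^' --> d.

Definition C1_on (R : realType) (V : normedModType (cplx R))
    (P : set (cplx R)) (h : cplx R -> V) : Prop :=
  exists2 h' : cplx R -> V, {within P, continuous h'} &
    forall t, P t -> derive_within P h t (h' t).

Definition reachable (F : fieldType) n (M : 'M[F]_n) (v : 'cV[F]_n) : Prop :=
  free [seq M ^+ i *m v | i <- iota 0 n].

Definition spectrum (F : fieldType) n (M : 'M[F]_n) : set F :=
  [set z | eigenvalue M z].

Definition simple_eigenvalues (F : fieldType) n (M : 'M[F]_n) : Prop :=
  forall z, spectrum M z -> mup z (char_poly M) = 1%N.

(* The input u does not depend on the parameter t. *)
Fixpoint solution (R : realType) n (A : cplx R -> 'M[cplx R]_n)
    (b : cplx R -> 'cV[cplx R]_n) (T : nat) (u : nat -> cplx R)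
    (x0 : cplx R -> 'cV[cplx R]_n) (t : cplx R) : 'cV[cplx R]_n :=
  if T is T'.+1 then A t *m solution A b T' u x0 t + u T' *: b t else x0 t.

Definition bernstein (R : realType) (a b : R) (g : cplx R -> cplx R) (m : nat) :
    {poly cplx R} :=
  ((b - a)%:C ^- m : cplx R) *:
  \sum_(j < m.+1)
    ('C(m, j)%:R * g (a + j%:R / m%:R * (b - a))%:C) *:
    (('X - (a%:C)%:P) ^+ j * ((b%:C)%:P - 'X) ^+ (m - j)).

(* The function (S^-1 f)_k \o lam^-1, where lam^-1 is the inverse of lam on P. *)
Definition coord_pullback (R : realType) n (P : set (cplx R))
    (S : cplx R -> 'M[cplx R]_n) (f : cplx R -> 'cV[cplx R]_n)
    (lam : cplx R -> cplx R) (k : 'I_n) : cplx R -> cplx R :=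
  (fun t => (invmx (S t) *m f t) k 0) \o pinv P lam.

(* Main.v *)
(* Writing v = S^-1 f and p = \sum_j q_j B_j, the state reached with the input
   (beta_N, ..., beta_0) is S (p(lam_1), ..., p(lam_n))^T, so the error is
   governed by p(lam_k) - v_k = \sum_j (q_j - h_j)(lam_k) B_j(lam_k)
   + (B_k - g_k)(lam_k), whose two parts are at most eps / (3 |S|) each.  For
   Lipschitz g the Bernstein error is at most (b - a) L / (2 sqrt m), by the
   variance of the binomial law, and this is already below the assumed rate.

   In the C^1 case put W = S(t)^-1 S(t').  Then
     W_ij (lam_j(t') - lam_i(t)) = (S(t)^-1 (A(t') - A(t)) S(t'))_ij.
   On the diagonal this shows that lam_k is differentiable along P with
   derivative (S^-1 A' S)_kk.  Off the diagonal, where lam_j(t') - lam_i(t) is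
   bounded away from 0, it shows that W_ij is dominated by the increments of A;
   the normalization S^-1 b = (1, ..., 1)^T then also bounds W_ii - 1.  When
   lam_k' does not vanish, lam_k^-1 is a C^1 parametrization of P by an
   interval, so the increments of A, b, f and hence of v_k are dominated by
   those of lam_k. *)
Require Import Defs.
From HB Require Import structures.
From mathcomp Require Import all_boot all_order all_algebra.
From mathcomp Require Import all_classical all_reals all_analysis.
From mathcomp Require Import complex.
From mathcomp Require Import ring lra zify.
Set Implicit Arguments.
Unset Strict Implicit.
Unset Printing Implicit Defensive.
Import Order.TTheory GRing.Theory Num.Theory.
Import numFieldNormedType.Exports.
Local Open Scope classical_set_scope.
Local Open Scope ring_scope.
Local Open Scope complex_scope.

(** * Real-valued norms over [R[i]] *)

Section Rnorm.
Variable R : realType.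
Section Space.
Variable V : normedZmodType (cplx R).
Implicit Types v w : V.

(** In the order of [R[i]], being nonnegative forces the imaginary part to vanish, so taking the
    real part loses nothing. *)
Lemma normr_rnorm v : `|v| = (rnorm v)%:C :> cplx R.
Proof.
rewrite /rnorm; have : 0 <= `|v| by [].
by case: `|v| => x y; rewrite lecE /= => /andP[/eqP -> _].
Qed.

Lemma rnorm_ge0 v : 0 <= rnorm v.
Proof. by have : 0 <= `|v| := normr_ge0 v; rewrite normr_rnorm lecR. Qed.

Lemma rnorm_le v (x : R) : (`|v| <= x%:C :> cplx R) = (rnorm v <= x).
Proof. by rewrite normr_rnorm lecR. Qed.

Lemma rnorm_lt v (x : R) : (`|v| < x%:C :> cplx R) = (rnorm v < x).
Proof. by rewrite normr_rnorm ltcR. Qed.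

Lemma rnorm0 : rnorm (0 : V) = 0.
Proof. by rewrite /rnorm normr0. Qed.

Lemma rnormN v : rnorm (- v) = rnorm v.
Proof. by rewrite /rnorm normrN. Qed.

Lemma rdistC v w : rnorm (v - w) = rnorm (w - v).
Proof. by rewrite -rnormN opprB. Qed.

Lemma rnormD v w : rnorm (v + w) <= rnorm v + rnorm w.
Proof.
have := ler_normD v w.
by rewrite !normr_rnorm -[X in _ <= X](rmorphD (real_complex R)) lecR.
Qed.

Lemma rnorm_sum (I : Type) (r : seq I) (Q : pred I) (F : I -> V) :
  rnorm (\sum_(i <- r | Q i) F i) <= \sum_(i <- r | Q i) rnorm (F i).
Proof.
elim/big_rec2 : _ => [|i x y _ le_yx]; first by rewrite rnorm0.
by rewrite (le_trans (rnormD _ _)) ?lerD2l.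
Qed.

End Space.

Lemma rnormM (x y : cplx R) : rnorm (x * y) = rnorm x * rnorm y.
Proof.
apply: (@complexI R).
by rewrite -normr_rnorm normrM !normr_rnorm rmorphM.
Qed.

Lemma rnormX (x : cplx R) k : rnorm (x ^+ k) = rnorm x ^+ k.
Proof.
by elim: k => [|k IH]; rewrite ?exprS ?rnormM ?IH // !expr0 /rnorm normr1.
Qed.

Lemma rnorm_real (x : R) : rnorm (x%:C : cplx R) = `|x|.
Proof.
apply: (@complexI R).
by rewrite -normr_rnorm normc_def /= expr0n addr0 sqrtr_sqr.
Qed.

(** The maximum norm is either 0 or attained at an entry; the first case includes empty matrices and
    rests on [0 <= x]. *)
Lemma rnorm_mx_le m k (M : 'M[cplx R]_(m, k)) (x : R) :
  0 <= x -> (forall i j, rnorm (M i j) <= x) -> rnorm M <= x.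
Proof.
move=> x0 Mx; rewrite -rnorm_le [leLHS]/Num.norm /=.
have [/eqP ->|/mx_norm_neq0 [i ->]] := boolP (mx_norm M == 0).
  by rewrite lecR.
by rewrite rnorm_le.
Qed.

Lemma rnorm_coord_le m k (M : 'M[cplx R]_(m, k)) i j :
  rnorm (M i j) <= rnorm M.
Proof.
rewrite -rnorm_le -normr_rnorm [leRHS]/Num.norm /= mx_normE.
rewrite -[leLHS]nngE num_le.
exact: (le_bigmax 0%:nng (fun ij => `|M ij.1 ij.2|%:nng) (i, j)).
Qed.

End Rnorm.

(** * Moments of the binomial law *)

Section BernsteinWeights.
Variables (R : realType) (s : R).

Definition bweight m j : R := 'C(m, j)%:R * s ^+ j * (1 - s) ^+ (m - j).

(** Pascal's rule, read as conditioning on one further trial: it fails with weight [1 - s], or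
    succeeds with weight [s] and shifts [j] by one. Total mass and variance then follow by induction
    on [m]. *)
Lemma bweight_sumS m (phi : nat -> R) :
  \sum_(j < m.+2) bweight m.+1 j * phi j =
  (1 - s) * (\sum_(j < m.+1) bweight m j * phi j) +
  s * \sum_(j < m.+1) bweight m j * phi j.+1.
Proof.
rewrite big_ord_recl /bweight /= !bin0 !subn0.
under eq_bigr => j _.
  rewrite /bump leq0n add1n binS natrD subSS !mulrDl.
  over.
rewrite big_split /= addrA; congr (_ + _).
  rewrite big_ord_recr /= bin_small // !mul0r addr0.
  rewrite [in RHS]big_ord_recl /= bin0 subn0 mulrDr mulr_sumr.
  congr (_ + _); first by rewrite !exprS; ring.
  apply: eq_bigr => j _; rewrite /bump leq0n add1n.
  have -> : (m - j = (m - j.+1).+1)%N by have := ltn_ord j; lia.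
  by rewrite !exprS; ring.
by rewrite mulr_sumr; apply: eq_bigr => j _; rewrite exprS; ring.
Qed.

Lemma bweight_sum m : \sum_(j < m.+1) bweight m j = 1.
Proof.
elim: m => [|m IH].
  by rewrite big_ord1 /bweight bin0 !expr0 !mulr1.
rewrite -[RHS](_ : (1 - s) * 1 + s * 1 = _); last by ring.
have E k : \sum_(j < k.+1) bweight k j * 1 = \sum_(j < k.+1) bweight k j.
  by apply: eq_bigr => j _; rewrite mulr1.
by have := bweight_sumS m (fun=> 1); rewrite !E IH.
Qed.

(** Each further trial adds $s(1-s)$: with $d=j-ms$ one has $(1-s)(d-s)^2+s(d+1-s)^2=d^2+s(1-s)$. *)
Lemma bweight_variance m :
  \sum_(j < m.+1) bweight m j * (j%:R - m%:R * s) ^+ 2 = m%:R * (s * (1 - s)).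
Proof.
elim: m => [|m IH].
  by rewrite big_ord1 /= !mul0r subr0 expr0n mulr0.
rewrite (bweight_sumS m (fun j => (j%:R - m.+1%:R * s) ^+ 2)).
rewrite !mulr_sumr -big_split /=.
rewrite (eq_bigr (fun j : 'I_m.+1 => bweight m j * (j%:R - m%:R * s) ^+ 2 +
    s * (1 - s) * bweight m j)) => [|j _]; last first.
  by rewrite -!natr1; ring.
rewrite big_split /= IH -mulr_sumr bweight_sum -!natr1; ring.
Qed.

Hypothesis s01 : 0 <= s <= 1.

Lemma bweight_ge0 m j : 0 <= bweight m j.
Proof.
have /andP[s0 s1] := s01.
by rewrite /bweight !mulr_ge0 ?exprn_ge0 ?subr_ge0.
Qed.

(* AM-GM in the form |d| <= r d^2 + 1 / (4 r) with r = sqrt m replaces the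
   Cauchy-Schwarz inequality. *)
Lemma bweight_mean_dist m : (0 < m)%N ->
  \sum_(j < m.+1) bweight m j * `|j%:R / m%:R - s| <= (2 * Num.sqrt m%:R)^-1.
Proof.
move=> m0; have mR : 0 < m%:R :> R by rewrite ltr0n.
set r := Num.sqrt m%:R; have r0 : 0 < r by rewrite sqrtr_gt0.
have rr : m%:R = r ^+ 2 by rewrite sqr_sqrtr // ltW.
apply: (@le_trans _ _ (\sum_(j < m.+1)
   (r ^-3 * (bweight m j * (j%:R - m%:R * s) ^+ 2) + (4 * r)^-1 * bweight m j))).
  apply: ler_sum => j _.
  rewrite [leRHS](_ : _ = bweight m j * (r * (j%:R / m%:R - s) ^+ 2 + (4 * r)^-1));
    last by rewrite rr; field; apply/lt0r_neq0.
  rewrite ler_wpM2l ?bweight_ge0 //.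
  set d := _ - s; rewrite -subr_ge0 -[d ^+ 2]real_normK ?num_real //.
  rewrite [leRHS](_ : _ = r * (`|d| - (2 * r)^-1) ^+ 2); last first.
    by field; apply/lt0r_neq0.
  by rewrite mulr_ge0 ?sqr_ge0 ?ltW.
rewrite big_split /= -!mulr_sumr bweight_variance bweight_sum mulr1 rr.
have : s * (1 - s) <= 4^-1 by have := sqr_ge0 (s - 2^-1); lra.
move=> s4; rewrite [leRHS](_ : _ = r^-3 * (r ^+ 2 * 4^-1) + (4 * r)^-1); last first.
  by field; apply/lt0r_neq0.
rewrite lerD2r; apply: ler_wpM2l; first by rewrite invr_ge0 exprn_ge0 // ltW.
by rewrite ler_pM2l // exprn_gt0.
Qed.

End BernsteinWeights.

(** * Bernstein approximation of Lipschitz functions *)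

Lemma bernstein_horner (R : realType) (a b : R) (g : cplx R -> cplx R) m (x : R) :
  a < b ->
  (bernstein a b g m).[x%:C] =
  \sum_(j < m.+1) (bweight ((x - a) / (b - a)) m j)%:C *
    g (a + j%:R / m%:R * (b - a))%:C.
Proof.
move=> ab; have ba0 : b - a != 0 by rewrite subr_eq0 gt_eqF.
rewrite /bernstein hornerZ horner_sum mulr_sumr; apply: eq_bigr => j _.
rewrite !hornerE /=.
rewrite [bweight _ _ _](_ : _ = (b - a) ^- m * ('C(m, j)%:R *
   ((x - a) ^+ j * (b - x) ^+ (m - j)))); last first.
  rewrite /bweight (_ : 1 - _ = (b - x) / (b - a)); last by field.
  rewrite !expr_div_n.
  rewrite -[X in _ = (_ ^- X) * _](subnKC (ltnSE (ltn_ord j))) exprD.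
  by field; rewrite !expf_neq0.
rewrite !(rmorphM, rmorphB, rmorphXn, fmorphV, rmorph_nat).
ring.
Qed.

(** The Bernstein value is an average of samples of [g]. Since the weights sum to 1, [g x] can be
    moved under the sum, and the Lipschitz bound leaves the mean distance of [j / m] from the
    rescaled point [s]. *)
Lemma bernstein_error (R : realType) (a b L : R) (g : cplx R -> cplx R) m (x : R) :
  a < b -> (0 < m)%N -> 0 <= L ->
  (forall y z, y \in `[a, b] -> z \in `[a, b] ->
     rnorm (g y%:C - g z%:C) <= L * `|y - z|) ->
  x \in `[a, b] ->
  rnorm ((bernstein a b g m).[x%:C] - g x%:C) <=
    (b - a) * L / (2 * Num.sqrt m%:R).
Proof.
move=> ab m0 L0 gL xab; have ba0 : b - a != 0 by rewrite subr_eq0 gt_eqF.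
have mR : 0 < m%:R :> R by rewrite ltr0n.
rewrite bernstein_horner //; set s := (x - a) / (b - a).
have xE : x = a + s * (b - a) by rewrite /s; field.
have s01 : 0 <= s <= 1.
  move: xab; rewrite in_itv /= => /andP[ax xb].
  rewrite /s divr_ge0 ?subr_ge0 ?(ltW ab) //=.
  by rewrite ler_pdivrMr ?subr_gt0 // mul1r lerB.
have /andP[s0 s1] := s01.
have -> : g x%:C = \sum_(j < m.+1) (bweight s m j)%:C * g x%:C.
  by rewrite -mulr_suml -rmorph_sum bweight_sum mul1r.
rewrite -sumrB; apply: le_trans (rnorm_sum _ _ _) _.
apply: (@le_trans _ _ ((b - a) * L *
    \sum_(j < m.+1) bweight s m j * `|j%:R / m%:R - s|)); last first.
  by rewrite ler_wpM2l ?bweight_mean_dist // mulr_ge0 // subr_ge0 ltW.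
rewrite mulr_sumr; apply: ler_sum => j _.
rewrite -mulrBr rnormM rnorm_real ger0_norm ?bweight_ge0 //.
rewrite mulrCA ler_wpM2l ?bweight_ge0 //.
have jm : 0 <= (j%:R / m%:R : R) <= 1.
  by rewrite divr_ge0 //= ler_pdivrMr // mul1r ler_nat -ltnS.
apply: le_trans (gL _ _ _ xab) _.
  rewrite in_itv /=; nra.
rewrite [X in `|X|](_ : _ = (j%:R / m%:R - s) * (b - a));
  last by rewrite {1}xE; ring.
rewrite normrM [`|b - a|]ger0_norm ?subr_ge0 ?(ltW ab) //.
by rewrite mulrA mulrC mulrA.
Qed.

(** From $1-\frac12\le e^{-1/2}$ one gets $e^{1/2}\le2\le3$. *)
Lemma half_le_ln3 (R : realType) : 2^-1 <= ln 3 :> R.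
Proof.
rewrite -[X in X <= _]expRK ler_ln ?posrE ?expR_gt0 //.
have := expR_ge1Dx (- 2^-1 : R); rewrite expRN => h.
have e0 := expR_gt0 (2^-1 : R).
have : expR (2^-1) * (1 - 2^-1) <= 1 :> R by rewrite -ler_pdivlMl // mulr1.
lra.
Qed.

(** For $m\ge3$ the factor $\sqrt{2\ln m}$ is at least 1, and the term $4M$ only enlarges the
    right-hand side. *)
Lemma bernstein_rate (R : realType) (M w L : R) m :
  (3 <= m)%N -> 0 <= M -> 0 <= w * L ->
  w * L / (2 * Num.sqrt m%:R) <=
  Num.sqrt 2 * (4 * M + w * L / 2) * Num.sqrt (ln m%:R / m%:R).
Proof.
move=> m3 M0 wL.
have mR : 0 < m%:R :> R by rewrite ltr0n; lia.
have ln2 : 2^-1 <= ln m%:R :> R.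
  apply: le_trans (half_le_ln3 R) _.
  by rewrite ler_ln ?posrE // ler_nat.
have s1 : 1 <= Num.sqrt 2 * Num.sqrt (ln m%:R) :> R.
  rewrite -sqrtrM // -[leLHS](sqrtr1 R) ler_sqrt; lra.
rewrite sqrtrM; last by lra.
rewrite sqrtrV ?(ltW mR) //.
set r := Num.sqrt m%:R; have r0 : 0 < r^-1 by rewrite invr_gt0 sqrtr_gt0.
rewrite [leLHS](_ : _ = w * L / 2 * r^-1); last by rewrite invfM; ring.
rewrite [leRHS](_ : _ = (4 * M + w * L / 2) *
  (Num.sqrt 2 * Num.sqrt (ln m%:R)) * r^-1); last by ring.
rewrite ler_pM2r //; apply: (@le_trans _ _ (4 * M + w * L / 2)); first by lra.
by rewrite ler_peMr //; lra.
Qed.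

(** * Spectrum of a diagonalized matrix *)

Lemma char_poly_similar (F : fieldType) n (A S : 'M[F]_n) :
  S \in unitmx -> char_poly (invmx S *m A *m S) = char_poly A.
Proof.
move=> uS; rewrite /char_poly.
have -> : char_poly_mx (invmx S *m A *m S) =
    map_mx polyC (invmx S) *m char_poly_mx A *m map_mx polyC S.
  rewrite /char_poly_mx !map_mxM mulmxBr mulmxBl; congr (_ - _).
  by rewrite scalar_mxC -mulmxA -map_mxM mulVmx // map_mx1 mulmx1.
rewrite !det_mulmx mulrAC -det_mulmx -map_mxM mulVmx // map_mx1 det1.
by rewrite mul1r.
Qed.

Section Diagonalized.
Variables (F : fieldType) (n : nat) (A S : 'M[F]_n) (lam : 'I_n -> F).
Hypothesis uS : S \in unitmx.
Hypothesis AS : invmx S *m A *m S = diag_mx (\row_k lam k).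

Lemma char_poly_diagonalized : char_poly A = \prod_k ('X - (lam k)%:P).
Proof.
rewrite -(char_poly_similar A uS) AS char_poly_trig ?diag_mx_is_trig //.
by apply: eq_bigr => k _; rewrite !mxE eqxx mulr1n.
Qed.

Lemma spectrum_diagonalized k : spectrum A (lam k).
Proof.
rewrite /spectrum /= eigenvalue_root_char char_poly_diagonalized.
rewrite -(big_map lam xpredT (fun a => 'X - a%:P)) root_prod_XsubC.
by rewrite map_f // mem_index_enum.
Qed.

(** A repeated value would make the square of a linear factor divide the characteristic
    polynomial. *)
Lemma diagonalized_inj : simple_eigenvalues A -> injective lam.
Proof.
move=> simA j k ejk; apply/eqP/negPn/negP => nejk.
have := simA _ (spectrum_diagonalized k); have := char_poly_diagonalized.
rewrite (bigD1 k) //= (bigD1 j) //= ejk mulrA -expr2 => eA.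
have A0 : char_poly A != 0 by rewrite monic_neq0 ?char_poly_monic.
move=> mA; have := mup_geq (lam k) 2 A0.
by rewrite mA {1}eA dvdp_mulr.
Qed.

End Diagonalized.

(** * The reached state in eigencoordinates *)

Lemma invmx_solution (R : realType) n (A : cplx R -> 'M[cplx R]_n)
    (b : cplx R -> 'cV[cplx R]_n) (S : 'M[cplx R]_n) (lam : 'I_n -> cplx R)
    (u : nat -> cplx R) t T k :
  S \in unitmx ->
  invmx S *m A t *m S = diag_mx (\row_k lam k) ->
  invmx S *m b t = const_mx 1 ->
  (invmx S *m solution A b T u (fun=> 0) t) k 0 =
    \sum_(i < T) u i * lam k ^+ (T - i.+1).
Proof.
move=> uS AS bS; elim: T => [|T IH] /=.
  by rewrite mulmx0 mxE big_ord0.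
set x := solution A b T _ _ _ in IH *.
rewrite mulmxDr -scalemxAr bS big_ord_recr /= subnn expr0.
have -> : invmx S *m (A t *m x) = diag_mx (\row_k lam k) *m (invmx S *m x).
  by rewrite -AS -!mulmxA mulKVmx.
rewrite mul_diag_mx mxE [in LHS]mxE IH !mxE; congr (_ + _).
rewrite mulr_sumr; apply: eq_bigr => i _.
by rewrite mulrCA -exprS subSS -subSn.
Qed.

Lemma invmx_solution_horner (R : realType) n (A : cplx R -> 'M[cplx R]_n)
    (b : cplx R -> 'cV[cplx R]_n) (S : 'M[cplx R]_n) (lam : 'I_n -> cplx R)
    (beta : nat -> cplx R) t N k :
  S \in unitmx ->
  invmx S *m A t *m S = diag_mx (\row_k lam k) ->
  invmx S *m b t = const_mx 1 ->
  (invmx S *m solution A b N.+1 (fun i => beta (N - i)%N) (fun=> 0) t) k 0 =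
    (\sum_(l < N.+1) beta l *: 'X^l).[lam k].
Proof.
move=> uS AS bS; rewrite (invmx_solution _ _ _ uS AS bS).
(* The input at time [i] is [beta (N - i)] and is multiplied by the power [N - i] of the eigenvalue,
   so reversing the summation gives the evaluation of the polynomial. *)
rewrite horner_sum (reindex_inj rev_ord_inj) /=; apply: eq_bigr => i _.
have iN : (i <= N)%N by rewrite -ltnS.
by rewrite !hornerE !subSS subKn.
Qed.

(** * Suprema of norms *)

Section Supnorm.
Variables (R : realType) (T : Type) (V : normedZmodType (cplx R)).
Implicit Types (D : set T) (h : T -> V).

(** A set without a supremum is given the value 0, so boundedness need not be known. *)
Lemma supnorm_ge0 D h : 0 <= supnorm D h.
Proof.
rewrite /supnorm; set E := [set _ | _ in _].
have [supE|/sup_out -> //] := pselect (has_sup E).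
have [y Ey] := supE.1; apply: le_trans (ub_le_sup supE.2 Ey).
by case: Ey => x _ <-; exact: rnorm_ge0.
Qed.

Lemma le_supnorm D h (M : R) x :
  (forall y, D y -> rnorm (h y) <= M) -> D x -> rnorm (h x) <= supnorm D h.
Proof.
move=> hM Dx; apply: ub_le_sup; last by exists x.
by exists M => _ [y Dy <-]; exact: hM.
Qed.

Lemma supnorm_le D h (M : R) : D !=set0 ->
  (forall y, D y -> rnorm (h y) <= M) -> supnorm D h <= M.
Proof.
move=> [x Dx] hM; apply: ge_sup; first by exists (rnorm (h x)), x.
by move=> _ [y Dy <-]; exact: hM.
Qed.

End Supnorm.

(** Makes the suprema of polynomials over the bounded eigenvalue images genuine upper bounds. *)
Lemma poly_bounded (R : realType) (p : {poly cplx R}) (c : R) :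
  exists M : R, forall z, rnorm z <= c -> rnorm p.[z] <= M.
Proof.
exists (\sum_(i < size p) rnorm p`_i * c ^+ i) => z zc.
rewrite horner_coef (le_trans (rnorm_sum _ _ _)) // ler_sum // => i _.
rewrite rnormM rnormX ler_wpM2l ?rnorm_ge0 //.
by rewrite lerXn2r // ?nnegrE ?rnorm_ge0 // (le_trans _ zc) ?rnorm_ge0.
Qed.

(** * The error estimate for the constructed input *)

Section Approximation.
Variables (R : realType) (n : nat) (P : set (cplx R)).
Variables (A : cplx R -> 'M[cplx R]_n) (b : cplx R -> 'cV[cplx R]_n).
Variables (lam : 'I_n -> cplx R -> cplx R) (S : cplx R -> 'M[cplx R]_n).
Variables (normM : 'M[cplx R]_n -> R) (f : cplx R -> 'cV[cplx R]_n).
Variables (lo hi : 'I_n -> R).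
Hypothesis P2 : exists t1 t2, [/\ P t1, P t2 & t1 <> t2].
Hypothesis lam_inj : forall j k t t', P t -> P t' -> lam j t = lam k t' ->
  j = k /\ t = t'.
Hypothesis uS : forall t, P t -> S t \in unitmx.
Hypothesis AS : forall t, P t ->
  invmx (S t) *m A t *m S t = diag_mx (\row_k lam k t).
Hypothesis bS : forall t, P t -> invmx (S t) *m b t = const_mx 1.
Hypothesis normMv : forall (X : 'M[cplx R]_n) (v : 'cV[cplx R]_n),
  rnorm (X *m v) <= normM X * rnorm v.
Hypothesis lamP : forall k,
  lam k @` P = [set (x%:C : cplx R) | x in `[lo k, hi k]].
Let g (k : 'I_n) := coord_pullback P S f (lam k) k.

Lemma coord_pullback_lam k t : P t -> g k (lam k t) = (invmx (S t) *m f t) k 0.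
Proof.
move=> Pt; rewrite /g /coord_pullback /= pinvKV ?inE //.
by move=> x y; rewrite !inE => Px Py /lam_inj [].
Qed.

Lemma lam_lohi k t : P t -> exists2 x : R, x \in `[lo k, hi k] & lam k t = x%:C.
Proof.
move=> Pt; have : (lam k @` P) (lam k t) by exists t.
by rewrite lamP => -[x xI <-]; exists x.
Qed.

(** An injective function takes two values on two points of [P], so its image interval is
    nondegenerate and the rescaling in the Bernstein polynomial is legitimate. *)
Lemma lo_lt_hi k : lo k < hi k.
Proof.
have [t1 [t2 [P1 P2' ne]]] := P2.
have [x1 + e1] := lam_lohi k P1; have [x2 + e2] := lam_lohi k P2'.
rewrite !in_itv /= => /andP[l1 h1] /andP[l2 h2].
rewrite ltNge; apply/negP => hl; apply: ne.
suff e : lam k t1 = lam k t2 by have [] := lam_inj P1 P2' e.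
rewrite e1 e2; congr (_%:C).
by apply/eqP; rewrite eq_le; apply/andP; split; lra.
Qed.

Lemma lam_bounded k : exists c : R, forall t, P t -> rnorm (lam k t) <= c.
Proof.
exists (`|lo k| + `|hi k|) => t Pt.
have [x + ->] := lam_lohi k Pt; rewrite rnorm_real in_itv /= => /andP[l h].
have := ler_norm (hi k); have := ler_norm (- lo k); rewrite normrN => ? ?.
by rewrite ler_norml; have := normr_ge0 (lo k); have := normr_ge0 (hi k); lra.
Qed.

Lemma approximation (eps : R) (L : 'I_n -> R) (m : 'I_n -> nat)
    (q : 'I_n -> {poly cplx R}) (N : nat) (beta : nat -> cplx R) :
  let normS := sup [set normM (S t) | t in P] in
  let M k := supnorm (lam k @` P) (g k) in
  let B k := bernstein (lo k) (hi k) (g k) (m k) in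
  let alpha k l := supnorm P (fun t => (B l).[lam k t]) in
  (0 < n)%N ->
  0 < eps ->
  (forall k, 0 < L k) ->
  (forall k, ((L k)%:C).-lipschitz_(lam k @` P) (g k)) ->
  (forall k, (3 <= m k)%N) ->
  (forall k,
    Num.sqrt 2 * (4 * M k + (hi k - lo k) * L k / 2)
      * Num.sqrt (ln (m k)%:R / (m k)%:R) < eps / (3 * normS)) ->
  (forall j k, 0 < \sum_l alpha k l ->
    supnorm (lam k @` P) (fun z => (q j).[z] - \1_(lam j @` P) z)
      < eps / (3 * normS * \sum_l alpha k l)) ->
  \sum_k q k * B k = \sum_(l < N.+1) beta l *: 'X^l ->
  supnorm P (fun t =>
    solution A b N.+1 (fun i => beta (N - i)%N) (fun=> 0) t - f t) < eps.
Proof.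
move=> normS M B alpha n0 eps0 L0 gL m3 mB qB pE.
have rate k : (hi k - lo k) * L k / (2 * Num.sqrt (m k)%:R) < eps / (3 * normS).
  apply: le_lt_trans (mB k); apply: bernstein_rate => //; first exact: supnorm_ge0.
  by rewrite mulr_ge0 ?(ltW (L0 k)) // subr_ge0 ltW // lo_lt_hi.
pose k0 := Ordinal n0.
(* The degree condition puts a nonnegative number strictly below this quotient; as division by 0
   yields 0, this also gives [0 < normS]. *)
have epsS : 0 < eps / (3 * normS).
  apply: le_lt_trans (rate k0); rewrite divr_ge0 ?mulr_ge0 ?sqrtr_ge0 //.
    by rewrite subr_ge0 ltW // lo_lt_hi.
  exact: ltW.
have S0 : 0 < normS by move: epsS; rewrite pmulr_rgt0 // invr_gt0 pmulr_rgt0.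
(* An unbounded set has supremum 0, so 0 < normS makes the S t bounded. *)
have normS_ge t : P t -> normM (S t) <= normS.
  move=> Pt; apply: ub_le_sup; last by exists t.
  apply: contrapT => nub; move: S0; rewrite /normS sup_out ?ltxx //.
  by case.
have alpha_ge k l t : P t -> rnorm (B l).[lam k t] <= alpha k l.
  have [c lamc] := lam_bounded k; have [K BK] := poly_bounded (B l) c.
  apply: (@le_supnorm _ _ _ P (fun t => (B l).[lam k t]) K) => // s Ps.
  exact/BK/lamc.
have errB k t : P t ->
    rnorm ((B k).[lam k t] - (invmx (S t) *m f t) k 0) < eps / (3 * normS).
  move=> Pt; rewrite -coord_pullback_lam //; apply: le_lt_trans (rate k).
  have [x xI ->] := lam_lohi k Pt.
  apply: bernstein_error => //; [exact: lo_lt_hi|exact: leq_trans (m3 k)|exact: ltW|].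
  move=> y z yI zI; rewrite -rnorm_le.
  have -> : (L k * `|y - z|)%:C = (L k)%:C * `|y%:C - z%:C : cplx R|.
    by rewrite normr_rnorm -rmorphB rnorm_real rmorphM.
  apply: (gL k (y%:C, z%:C)); rewrite lamP; split; first by exists y.
  by exists z.
have errq k j t : P t -> 0 < \sum_l alpha k l ->
    rnorm ((q j).[lam k t] - (j == k)%:R) < eps / (3 * normS * \sum_l alpha k l).
  move=> Pt a0; apply: le_lt_trans (qB j k a0).
  (* The images of distinct eigenvalue functions are disjoint. *)
  have -> : (j == k)%:R = \1_(lam j @` P) (lam k t) :> cplx R.
    rewrite indicE; congr (_ %:R); congr nat_of_bool; apply/eqP/idP.
      by move=> ->; rewrite inE; exists t.
    by rewrite inE => -[s Ps /lam_inj []].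
  have [c lamc] := lam_bounded k; have [K qK] := poly_bounded (q j) c.
  apply: (@le_supnorm _ _ _ _ (fun z => (q j).[z] - \1_(lam j @` P) z) (K + 1)).
    move=> _ [s Ps <-]; rewrite (le_trans (rnormD _ _)) // lerD ?qK ?lamc //.
    rewrite rnormN indicE; case: (_ \in _); last by rewrite rnorm0 ler01.
    by rewrite /rnorm normr1.
  by exists t.
have err k t : P t -> rnorm ((\sum_j q j * B j).[lam k t] - (invmx (S t) *m f t) k 0)
    <= eps / (3 * normS) + eps / (3 * normS).
  move=> Pt; set fk := (_ *m _) k 0.
  have -> : (\sum_j q j * B j).[lam k t] - fk =
     (\sum_j ((q j).[lam k t] - (j == k)%:R) * (B j).[lam k t]) +
     ((B k).[lam k t] - fk).
    rewrite addrA; congr (_ - _); rewrite horner_sum.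
    have -> : (B k).[lam k t] = \sum_j (j == k)%:R * (B j).[lam k t].
      rewrite (bigD1 k) //= eqxx mul1r big1 ?addr0 // => j /negPf ->.
      by rewrite mul0r.
    by rewrite -big_split; apply: eq_bigr => j _; rewrite /= hornerM; ring.
  apply: le_trans (rnormD _ _) _; apply: lerD; last exact/ltW/errB.
  apply: le_trans (rnorm_sum _ _ _) _.
  (* If the sum is 0, every [B j] vanishes at [lam k t], so the first part of the error is 0 and no
     bound on [q] is called for. *)
  have [a0|] := ltP 0 (\sum_l alpha k l); last first.
    rewrite le_eqVlt ltNge sumr_ge0 ?orbF => [|l _]; last exact: supnorm_ge0.
    rewrite psumr_eq0 => [/allP aE|l _]; last exact: supnorm_ge0.
    rewrite big1 ?(ltW epsS) // => j _; rewrite rnormM.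
    have /eqP aj := aE j (mem_index_enum _).
    have := alpha_ge k j t Pt; rewrite aj => Bj.
    have /eqP -> : rnorm (B j).[lam k t] == 0 by rewrite eq_le Bj rnorm_ge0.
    by rewrite mulr0.
  apply: (@le_trans _ _ (\sum_j eps / (3 * normS * \sum_l alpha k l) * alpha k j)).
    apply: ler_sum => j _; rewrite rnormM ler_pM ?rnorm_ge0 ?alpha_ge //.
    exact/ltW/errq.
  rewrite -mulr_sumr invfM mulrA -mulrA mulVf ?mulr1 //; exact: lt0r_neq0.
have {err} err t : P t ->
    rnorm (solution A b N.+1 (fun i => beta (N - i)%N) (fun=> 0) t - f t)
      <= 2 / 3 * eps.
  move=> Pt; set x := solution _ _ _ _ _ _.
  rewrite -[x](mulKVmx (uS Pt)) -[f t](mulKVmx (uS Pt)) -mulmxBr.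
  apply: le_trans (normMv _ _) _.
  have -> : 2 / 3 * eps = normS * (eps / (3 * normS) + eps / (3 * normS)).
    by field; rewrite lt0r_neq0.
  apply: le_trans (ler_wpM2r (rnorm_ge0 _) (normS_ge t Pt)) _.
  rewrite ler_pM2l //; apply: rnorm_mx_le => [|k j].
    by rewrite addr_ge0 // ltW.
  rewrite ord1 mxE [X in _ + X]mxE /x.
  rewrite (invmx_solution_horner _ _ _ (uS Pt) (AS Pt) (bS Pt)) -pE.
  exact: err.
(* The two error parts use two thirds of [eps]; the last third keeps the inequality strict after
   passing to the supremum. *)
apply: (@le_lt_trans _ _ (2 / 3 * eps)); last by lra.
have [t1 [_ [Pt1 _ _]]] := P2.
by apply: supnorm_le => //; exists t1.
Qed.

End Approximation.

(** * Compactness of Jordan arcs and bounds on compact sets *)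

Section Compactness.
Variables (R : realType) (P : set (cplx R)).

Lemma jordan_arc_compact : jordan_arc P -> compact P.
Proof.
move=> [a [b [gam [del [_ cgam <- _ _]]]]].
by apply: continuous_compact => //; exact: segment_compact.
Qed.

Lemma jordan_arc_two_points : jordan_arc P ->
  exists t1 t2, [/\ P t1, P t2 & t1 <> t2].
Proof.
move=> [a [b [gam [del [ab _ gamP gamK _]]]]].
have aI : a \in `[a, b] by rewrite in_itv /= lexx ltW.
have bI : b \in `[a, b] by rewrite in_itv /= lexx ltW.
exists (gam a), (gam b); rewrite -gamP; split; first by exists a.
  by exists b.
move=> e; have := gamK b bI; rewrite -e gamK // => eab.
by rewrite eab ltxx in ab.
Qed.

(** Compactness enters in its near-covering form with the bound [M] as the variable tending to
    infinity: the local bounds [|h t| + 1] merge into one without extracting a finite subcover. *)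
Lemma rnorm_bounded_within (h : cplx R -> cplx R) (K : set (cplx R)) :
  compact K -> (forall t, K t -> h @ within K (nbhs t) --> h t) ->
  exists M : R, forall t, K t -> rnorm (h t) <= M.
Proof.
move=> /compact_near_coveringP/near_covering_withinP cK hK.
have /cK : forall t, K t -> \forall t' \near t & M \near (+oo : set_system R),
    K t' -> rnorm (h t') <= M.
  move=> t Kt.
  have : \forall t' \near within K (nbhs t), `|h t'| < `|h t| + 1.
    by apply: cvgr_norm_lt (hK t Kt) _ _; rewrite ltrDl ltr01.
  rewrite near_withinE => near_t.
  exists ([set t' | K t' -> `|h t'| < `|h t| + 1], [set M | rnorm (h t) + 1 < M]).
    by split => //=; apply: nbhs_pinfty_gt; rewrite num_real.
  move=> [t' M] /= [+ hM] Kt' => /(_ Kt').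
  rewrite normr_rnorm [in X in _ < X]normr_rnorm -[1]/(1%:C) -rmorphD ltcR => ht'.
  exact/ltW/(lt_trans ht').
by move=> /filter_ex [M MK]; exists M.
Qed.

End Compactness.

(** * From local to global Lipschitz bounds on an interval *)

(** Let [s] be the supremum of the points up to which the bound from [x] holds. The local estimate
    to the left of [s] gives the bound at [s], and if [s < y] the estimate to its right goes beyond
    [s]. The local hypothesis only compares with its centre, as a bound on a derivative does. *)
Lemma local_lipschitz (R : realType) (V : normedZmodType (cplx R)) (a b K : R)
    (h : R -> V) :
  0 <= K ->
  (forall x, x \in `[a, b] -> exists2 d : R, 0 < d &
     forall y, y \in `[a, b] -> `|y - x| < d -> rnorm (h y - h x) <= K * `|y - x|) ->
  forall x y, x \in `[a, b] -> y \in `[a, b] -> rnorm (h y - h x) <= K * `|y - x|.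
Proof.
move=> K0 loc x y; wlog xy : x y / x <= y.
  move=> W xI yI; have [xy|/ltW yx] := leP x y; first exact: W.
  by rewrite rdistC distrC; exact: W.
rewrite !in_itv /= => /andP[ax _] /andP[_ yb].
pose E := [set z : R | [/\ x <= z, z <= y & rnorm (h z - h x) <= K * (z - x)]].
have Ex : E x by split; rewrite // !subrr rnorm0 mulr0.
have Eub : has_ubound E by exists y => z [].
have supE : has_sup E by split => //; exists x.
set s := sup E.
have xs : x <= s by exact: ub_le_sup.
have sy : s <= y by apply: ge_sup; [exists x|move=> z []].
have sI : s \in `[a, b] by rewrite in_itv /=; lra.
have [d d0 sd] := loc s sI.
have [z [xz zy hz] zs] := sup_adherent d0 supE.
have zs' : z <= s by apply: ub_le_sup.
have hs : rnorm (h s - h x) <= K * (s - x).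
  have := rnormD (h s - h z) (h z - h x); rewrite subrKA.
  have zI : z \in `[a, b] by rewrite in_itv /=; lra.
  have := sd z zI; rewrite rdistC distrC ger0_norm ?subr_ge0 // => /(_ _).
  move=> /(_ ltac:(rewrite -/s in zs; lra)); nra.
have [->|nsy] := eqVneq y s; first by rewrite ger0_norm // subr_ge0.
have lsy : s < y by rewrite lt_neqAle eq_sym nsy.
pose w := Num.min y (s + d / 2).
have sw : s < w by rewrite lt_min lsy /= ltrDl divr_gt0.
have wy : w <= y by rewrite ge_min lexx.
have wsd : w <= s + d / 2 by rewrite ge_min lexx orbT.
suff : w <= s by rewrite leNgt sw.
apply: ub_le_sup => //; split => //; first by rewrite (le_trans xs) // ltW.
have wI : w \in `[a, b] by rewrite in_itv /=; lra.
have := rnormD (h w - h s) (h s - h x); rewrite subrKA.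
have := sd w wI; rewrite ger0_norm ?subr_ge0 ?(ltW sw) // => /(_ _).
move=> /(_ ltac:(lra)); nra.
Qed.

(** * Entrywise limits of matrix operations *)

Section MatrixLimits.
Variables (K : numFieldType) (T : Type) (F : set_system T).
Hypothesis FF : Filter F.

Lemma cvg_scalar_sum (I : Type) (r : seq I) (Q : pred I)
    (h : I -> T -> K) (l : I -> K) :
  (forall i, Q i -> h i @ F --> l i) ->
  (fun x => \sum_(i <- r | Q i) h i x) @ F --> \sum_(i <- r | Q i) l i.
Proof. by move=> hl; apply: cvg_big hl => //; exact: add_continuous. Qed.

Lemma cvg_scalar_prod (I : Type) (r : seq I) (Q : pred I)
    (h : I -> T -> K) (l : I -> K) :
  (forall i, Q i -> h i @ F --> l i) ->
  (fun x => \prod_(i <- r | Q i) h i x) @ F --> \prod_(i <- r | Q i) l i.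
Proof. by move=> hl; apply: cvg_big hl => //; exact: mul_continuous. Qed.

Lemma cvg_mulmx_entry m n p (M : T -> 'M[K]_(m, n)) (N : T -> 'M[K]_(n, p))
    (M0 : 'M[K]_(m, n)) (N0 : 'M[K]_(n, p)) i j :
  (forall i j, (fun x => M x i j) @ F --> M0 i j) ->
  (forall i j, (fun x => N x i j) @ F --> N0 i j) ->
  (fun x => (M x *m N x) i j) @ F --> (M0 *m N0) i j.
Proof.
move=> cM cN; rewrite mxE; under eq_cvg do rewrite mxE.
by apply: cvg_scalar_sum => l _; exact: cvgM.
Qed.

Lemma cvg_det n (M : T -> 'M[K]_n) (M0 : 'M[K]_n) :
  (forall i j, (fun x => M x i j) @ F --> M0 i j) ->
  (fun x => \det (M x)) @ F --> \det M0.
Proof.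
move=> cM; apply: cvg_scalar_sum => s _; apply: cvgM; first exact: cvg_cst.
exact: cvg_scalar_prod.
Qed.

Lemma cvg_invmx_entry n (M : T -> 'M[K]_n) (M0 : 'M[K]_n) i j :
  (\forall x \near F, M x \in unitmx) -> M0 \in unitmx ->
  (forall i j, (fun x => M x i j) @ F --> M0 i j) ->
  (fun x => invmx (M x) i j) @ F --> invmx M0 i j.
Proof.
move=> uM uM0 cM.
(* Cramer's rule reduces the limit to limits of determinants. *)
have invE (X : 'M[K]_n) : X \in unitmx ->
    invmx X i j = (\det X)^-1 * ((-1) ^+ (j + i) * \det (row' j (col' i X))).
  by move=> uX; rewrite /invmx uX !mxE.
rewrite invE //.
apply: (@cvg_trans _ ((fun x => (\det (M x))^-1 *
   ((-1) ^+ (j + i) * \det (row' j (col' i (M x))))) @ F)).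
  by apply: near_eq_cvg; apply: filterS uM => x /invE.
apply: cvgM; first by apply: cvgV; [rewrite -unitfE -unitmxE|exact: cvg_det].
apply: cvgM; first exact: cvg_cst.
apply: cvg_det => i' j'; rewrite !mxE; under eq_cvg do rewrite !mxE.
exact: cM.
Qed.

End MatrixLimits.

(** * Parametrizing the arc by a real-valued injective function *)

Section Reparametrization.
Variables (R : realType) (P : set (cplx R)) (l : cplx R -> cplx R) (lo hi : R).
Hypothesis cP : compact P.
Hypothesis l_cont : forall t, P t -> l @ within P (nbhs t) --> l t.
Hypothesis l_inj : forall t t', P t -> P t' -> l t = l t' -> t = t'.
Hypothesis lP : l @` P = [set (x%:C : cplx R) | x in `[lo, hi]].

(** This is continuity of the inverse of [l] at [l t], phrased on [P]. *)
Lemma inverse_continuous_at t (U : set (cplx R)) : P t -> nbhs t U ->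
  exists2 d : R, 0 < d & forall t', P t' -> rnorm (l t' - l t) < d -> U t'.
Proof.
move=> Pt tU; (* The continuous function 1 / (l s - l t) is bounded on the compact set K. *)
pose K := P `&` ~` U°.
have cK : compact K.
  by apply: compact_closedI => //; apply: open_closedC; exact: open_interior.
have lt0 s : K s -> l s - l t != 0.
  move=> [Ps nUs]; rewrite subr_eq0; apply/eqP => /(l_inj Ps Pt) st.
  by apply: nUs; rewrite st.
have [] := @rnorm_bounded_within R (fun s => (l s - l t)^-1) K cK.
  move=> s Ks; apply: cvgV; first exact: lt0.
  apply: cvgB; last exact: cvg_cst.
  apply: cvg_trans (l_cont Ks.1).
  by apply: cvg_app; apply: within_subset => // z [].
move=> M KM; exists (`|M| + 1)^-1; first by rewrite invr_gt0 ltr_pwDr.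
move=> t' Pt' ltd; apply: contrapT => nUt'.
have Kt' : K t' by split => // /interior_subset.
have := KM t' Kt'; set z := l t' - l t in ltd *; have z0 : z != 0 by exact: lt0.
have : rnorm z * rnorm z^-1 = 1 by rewrite -rnormM mulfV // /rnorm normr1.
have M0 : 0 < `|M| + 1 by rewrite ltr_pwDr.
move: ltd; rewrite -[X in _ < X]mul1r ltr_pdivlMr //.
have := ler_norm M; have := rnorm_ge0 z; have := rnorm_ge0 z^-1.
move: (rnorm z) (rnorm z^-1) => u v; nra.
Qed.

(** [F] depends on both parameters so that mixed terms such as $S(t)^{-1}S(t')-1$ are covered along
    with differences [phi t' - phi t]. *)
Definition increment_dominated (F : cplx R -> cplx R -> cplx R) :=
  exists C : R, forall t t', P t -> P t' -> rnorm (F t t') <= C * rnorm (l t' - l t).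

(** Along the interval, $\phi\circ l^{-1}$ has derivative $\phi'/l'$, which is bounded because [P]
    is compact; a bounded derivative gives a Lipschitz bound. *)
Lemma increment_dominated_deriv (phi dphi dl : cplx R -> cplx R) :
  (forall t, P t -> derive_within P phi t (dphi t)) ->
  (forall t, P t -> dphi @ within P (nbhs t) --> dphi t) ->
  (forall t, P t -> derive_within P l t (dl t)) ->
  (forall t, P t -> dl @ within P (nbhs t) --> dl t) ->
  (forall t, P t -> dl t != 0) ->
  increment_dominated (fun t t' => phi t' - phi t).
Proof.
move=> phi' dphi_cont l' dl_cont dl0.
have [] := @rnorm_bounded_within R (fun s => dphi s * (dl s)^-1) P cP.
  move=> s Ps; apply: cvgM; first exact: dphi_cont.
  by apply: cvgV; [exact: dl0|exact: dl_cont].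
move=> M PM; pose K := `|M| + 1.
have K0 : 0 <= K by rewrite addr_ge0.
have scaleE (x y : cplx R) : x *: y = x * y by [].
pose mu (x : R) : cplx R := pinv P l x%:C.
have muP x : x \in `[lo, hi] -> P (mu x) /\ l (mu x) = x%:C.
  move=> xI; have : (l @` P) x%:C by rewrite lP; exists x.
  move=> [t Pt lt]; rewrite /mu -lt pinvKV ?inE //.
  by move=> y z; rewrite !inE; exact: l_inj.
have muK t : P t -> exists2 x, x \in `[lo, hi] & t = mu x.
  move=> Pt; have : (l @` P) (l t) by exists t.
  rewrite lP => -[x xI xl]; exists x => //; rewrite /mu xl pinvKV ?inE //.
  by move=> y z; rewrite !inE; exact: l_inj.
exists K => _ _ /muK [x xI ->] /muK [y yI ->].
rewrite (muP _ xI).2 (muP _ yI).2 -rmorphB rnorm_real.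
apply: (@local_lipschitz _ _ lo hi K (phi \o mu)) => // {xI yI y} {}x xI.
have [Pt lt] := muP x xI; set t := mu x in Pt lt *.
(* The quotient of the two difference quotients tends to [dphi t / dl t], of norm at most [M]; the
   extra 1 in [K] makes the bound strict and hence valid nearby. *)
have : \forall z \near within P t^',
   `|((z - t)^-1 *: (phi z - phi t)) * ((z - t)^-1 *: (l z - l t))^-1| < K%:C.
  apply: (@cvgr_norm_lt _ _ _ _ _ (fun z => _) (dphi t * (dl t)^-1)).
    apply: cvgM; first exact: phi'.
    by apply: cvgV; [exact: dl0|exact: l'].
  by rewrite rnorm_lt (le_lt_trans (PM t Pt)) // /K ltr_pwDr // ler_norm.
rewrite near_withinE /dnbhs near_withinE => /(inverse_continuous_at Pt) [d d0 tU].
exists d => // y yI yx; have [Pt' lt'] := muP y yI.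
have dist : rnorm (l (mu y) - l t) = `|y - x| by rewrite lt lt' -rmorphB rnorm_real.
have /= U := tU _ Pt' (eq_ind_r (fun r => r < d) yx dist).
have [->|ne] := eqVneq (mu y) t; first by rewrite subrr rnorm0 mulr_ge0.
have := U ne Pt'; rewrite rnorm_lt.
have dt0 : mu y - t != 0 by rewrite subr_eq0.
have dl_neq0 : l (mu y) - l t != 0.
  by rewrite subr_eq0; apply/eqP => /(l_inj Pt' Pt) /eqP; apply/negP.
rewrite ![_^-1 *: _]scaleE. rewrite [X in rnorm X](_ : _ =
   (phi (mu y) - phi t) * (l (mu y) - l t)^-1); last by field; exact/andP.
move=> /ltW hK; rewrite /= -(divfK dl_neq0 (phi (mu y) - phi t)) rnormM dist.
exact: ler_wpM2r.
Qed.

End Reparametrization.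

(** * Comparing the eigenbases at two parameters *)

Section EigenbasisChange.
Variables (F : fieldType) (n : nat) (A A' S S' : 'M[F]_n) (lam lam' : 'I_n -> F).
Hypotheses (uS : S \in unitmx) (uS' : S' \in unitmx).
Hypothesis AS : invmx S *m A *m S = diag_mx (\row_k lam k).
Hypothesis AS' : invmx S' *m A' *m S' = diag_mx (\row_k lam' k).
Let W := invmx S *m S'.

(** With [D] and [D'] the two diagonal matrices, $S^{-1}AS'=DW$ and $S^{-1}A'S'=WD'$. *)
Lemma eigenbasis_change i j :
  W i j * (lam' j - lam i) = (invmx S *m (A' - A) *m S') i j.
Proof.
have -> : invmx S *m (A' - A) *m S' =
    W *m diag_mx (\row_k lam' k) - diag_mx (\row_k lam k) *m W.
  by rewrite -AS -AS' /W mulmxBr mulmxBl -!mulmxA (mulKVmx uS') (mulKVmx uS).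
by rewrite mul_mx_diag mul_diag_mx !mxE; ring.
Qed.

(** Recovers the diagonal entry of $W-1$ from the off-diagonal ones, since $W$ sends $(1,\dots,1)^T$
    to $S^{-1}b'$. *)
Lemma eigenbasis_change_row_sum (b b' : 'cV[F]_n) k :
  invmx S *m b = const_mx 1 -> invmx S' *m b' = const_mx 1 ->
  \sum_j (W k j - (k == j)%:R) = (invmx S *m (b' - b)) k 0.
Proof.
move=> bS bS'; have -> : invmx S *m (b' - b) = (W - 1%:M) *m const_mx 1.
  by rewrite mulmxBl mul1mx -{1}bS' /W -mulmxA (mulKVmx uS') mulmxBr bS.
by rewrite mxE; apply: eq_bigr => j _; rewrite !mxE mulr1.
Qed.

(** Reduces an increment of coordinates to the increment of the vector and to $W-1$. *)
Lemma eigenbasis_change_coord (v v' : 'cV[F]_n) k :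
  (invmx S' *m v') k 0 - (invmx S *m v) k 0 =
  (invmx S *m (v' - v)) k 0 - \sum_j (W k j - (k == j)%:R) * (invmx S' *m v') j 0.
Proof.
have -> : \sum_j (W k j - (k == j)%:R) * (invmx S' *m v') j 0 =
    ((W - 1%:M) *m (invmx S' *m v')) k 0.
  by rewrite [RHS]mxE; apply: eq_bigr => j _; congr (_ * _); rewrite !mxE.
have -> : (W - 1%:M) *m (invmx S' *m v') = invmx S *m v' - invmx S' *m v'.
  by rewrite mulmxBl mul1mx /W -mulmxA (mulKVmx uS').
rewrite mulmxBr; move: (invmx S *m v) (invmx S *m v') (invmx S' *m v') => x y z.
by rewrite !mxE; ring.
Qed.

End EigenbasisChange.

(** * Closure properties of dominated increments *)

Section Domination.
Variables (R : realType) (P : set (cplx R)) (l : cplx R -> cplx R).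
Local Notation dominated := (increment_dominated P l).

Lemma increment_dominated_eq (F G : cplx R -> cplx R -> cplx R) :
  (forall t t', P t -> P t' -> F t t' = G t t') -> dominated G -> dominated F.
Proof. by move=> FG [C GC]; exists C => t t' Pt Pt'; rewrite FG //; exact: GC. Qed.

Lemma increment_dominatedB F G : dominated F -> dominated G ->
  dominated (fun t t' => F t t' - G t t').
Proof.
move=> [C FC] [D GD]; exists (C + D) => t t' Pt Pt'.
by rewrite (le_trans (rnormD _ _)) // rnormN mulrDl lerD ?FC ?GD.
Qed.

Lemma increment_dominated_sum (I : finType) (Q : pred I)
    (F : I -> cplx R -> cplx R -> cplx R) :
  (forall i, Q i -> dominated (F i)) ->
  dominated (fun t t' => \sum_(i | Q i) F i t t').
Proof.
move=> FD; have /choice [C FC] : forall i, exists C, Q i -> forall t t', P t -> P t' ->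
    rnorm (F i t t') <= C * rnorm (l t' - l t).
  move=> i; have [/FD [C FC]|nQ] := boolP (Q i); first by exists C.
  by exists 0.
exists (\sum_(i | Q i) C i) => t t' Pt Pt'.
rewrite (le_trans (rnorm_sum _ _ _)) // mulr_suml ler_sum // => i Qi.
exact: FC.
Qed.

Lemma increment_dominatedM (F G : cplx R -> cplx R -> cplx R) :
  (exists M : R, forall t t', P t -> P t' -> rnorm (G t t') <= M) ->
  dominated F -> dominated (fun t t' => G t t' * F t t').
Proof.
move=> [M GM] [C FC]; exists (M * C) => t t' Pt Pt'.
by rewrite rnormM -mulrA ler_pM ?rnorm_ge0 ?GM ?FC.
Qed.

Lemma increment_dominated_lip (h : cplx R -> cplx R) (K : R) :
  (forall t t', P t -> P t' -> rnorm (h t' - h t) <= K * rnorm (t' - t)) -> 0 <= K ->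
  dominated (fun t t' => t' - t) -> dominated (fun t t' => h t' - h t).
Proof.
move=> hK K0 [C idC]; exists (K * C) => t t' Pt Pt'.
by rewrite (le_trans (hK _ _ Pt Pt')) // -mulrA ler_wpM2l // idC.
Qed.

End Domination.

(** * Lipschitz coordinates in the continuously differentiable case *)

Section C1Case.
Variables (R : realType) (n : nat) (P : set (cplx R)).
Variables (A A' : cplx R -> 'M[cplx R]_n) (b b' : cplx R -> 'cV[cplx R]_n).
Variables (lam : 'I_n -> cplx R -> cplx R) (S : cplx R -> 'M[cplx R]_n).
Variables (f : cplx R -> 'cV[cplx R]_n) (lo hi : 'I_n -> R).
Hypothesis cP : compact P.
Hypothesis P2 : exists t1 t2, [/\ P t1, P t2 & t1 <> t2].
Hypothesis lam_inj : forall j k t t', P t -> P t' -> lam j t = lam k t' ->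
  j = k /\ t = t'.
Hypothesis lam_cont : forall k, {within P, continuous (lam k)}.
Hypothesis S_cont : {within P, continuous S}.
Hypothesis uS : forall t, P t -> S t \in unitmx.
Hypothesis AS : forall t, P t ->
  invmx (S t) *m A t *m S t = diag_mx (\row_k lam k t).
Hypothesis bS : forall t, P t -> invmx (S t) *m b t = const_mx 1.
Hypothesis lamP : forall k,
  lam k @` P = [set (x%:C : cplx R) | x in `[lo k, hi k]].
Hypothesis A'_cont : {within P, continuous A'}.
Hypothesis dA : forall t, P t -> derive_within P A t (A' t).
Hypothesis b'_cont : {within P, continuous b'}.
Hypothesis db : forall t, P t -> derive_within P b t (b' t).
Hypothesis f_cont : {within P, continuous f}.
Hypothesis f_lip : lip_on P f.

Lemma cvg_entry m p (h : cplx R -> 'M[cplx R]_(m, p)) i j t :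
  {within P, continuous h} -> P t ->
  (fun z => h z i j) @ within P (nbhs t) --> h t i j.
Proof.
move=> /subspace_continuousP hc Pt.
exact: (cvg_comp _ (fun M : 'M[cplx R]_(m, p) => M i j) (hc t Pt)
  (@coord_continuous _ _ _ i j (h t))).
Qed.

Lemma cvg_difference_quotient_entry m p (h : cplx R -> 'M[cplx R]_(m, p)) d i j
    (t : cplx R) :
  derive_within P h t d ->
  (fun z => ((z - t)^-1 *: (h z - h t)) i j) @ within P t^' --> d i j.
Proof.
move=> hd.
exact: (cvg_comp _ (fun M : 'M[cplx R]_(m, p) => M i j) hd
  (@coord_continuous _ _ _ i j d)).
Qed.

Lemma derive_within_entry m p (h : cplx R -> 'M[cplx R]_(m, p)) d i j t :
  derive_within P h t d -> derive_within P (fun z => h z i j) t (d i j).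
Proof.
move=> hd; rewrite /derive_within.
apply: (@cvg_trans _ ((fun z => ((z - t)^-1 *: (h z - h t)) i j) @ within P t^'));
  last exact: cvg_difference_quotient_entry.
by apply: near_eq_cvg; apply: nearW => z; rewrite !mxE.
Qed.

Lemma cvg_within_dnbhs (h : cplx R -> cplx R) (t x : cplx R) :
  h @ within P (nbhs t) --> x -> h @ within P t^' --> x.
Proof.
move=> ht; apply: cvg_trans ht; apply: cvg_app => U.
exact: nbhs_dnbhs.
Qed.

Lemma cvg_invmx_S i j t : P t ->
  (fun z => invmx (S z) i j) @ within P (nbhs t) --> invmx (S t) i j.
Proof.
move=> Pt; apply: cvg_invmx_entry; last by move=> ? ?; exact: cvg_entry.
  by apply: filterS (withinT _ _) => z; exact: uS.
exact: uS.
Qed.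

(* The first-order perturbation of a simple eigenvalue. *)
Definition dlam k t := (invmx (S t) *m A' t *m S t) k k.

Lemma dlam_cont k t : P t -> dlam k @ within P (nbhs t) --> dlam k t.
Proof.
move=> Pt; apply: cvg_mulmx_entry => i j; last exact: cvg_entry.
apply: cvg_mulmx_entry => i' j'; first exact: cvg_invmx_S.
exact: cvg_entry.
Qed.

Lemma derive_within_lam k t : P t -> derive_within P (lam k) t (dlam k t).
Proof.
move=> Pt; rewrite /derive_within.
have S_t i j : (fun z => S z i j) @ within P t^' --> S t i j.
  exact/cvg_within_dnbhs/cvg_entry.
have W1 : (fun z => (invmx (S t) *m S z) k k) @ within P t^' --> (1 : cplx R).
  have -> : (1 : cplx R) = (invmx (S t) *m S t) k k.
    by rewrite mulVmx ?uS // mxE eqxx.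
  apply: (@cvg_mulmx_entry _ _ _ _ _ _ _ (fun=> invmx (S t)) S).
    by move=> i j; exact: cvg_cst.
  exact: S_t.
(* Near [t] the entry $W_{kk}$ is close to 1, so [eigenbasis_change] on the diagonal can be divided
   by it; continuity of [S] then suffices for the limit. *)
apply: (@cvg_trans _ ((fun z => ((invmx (S t) *m S z) k k)^-1 *
   (invmx (S t) *m ((z - t)^-1 *: (A z - A t)) *m S z) k k) @ within P t^')).
  apply: near_eq_cvg.
  have near_W0 : within P t^' [set z | (invmx (S t) *m S z) k k != 0].
    apply: (@cvgr_neq0 _ _ _ _ _ (fun z => (invmx (S t) *m S z) k k) 1 W1).
    exact: oner_neq0.
  have near_Pz : within P t^' P by exact: withinT.
  apply: filterS2 near_W0 near_Pz => z /= W0 Pz.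
  rewrite -scalemxAr -scalemxAl [X in _ * X = _]mxE mulrCA.
  by rewrite -(eigenbasis_change (uS Pt) (uS Pz) (AS Pt) (AS Pz)) mulKf.
have -> : dlam k t = 1^-1 * dlam k t by rewrite invr1 mul1r.
apply: cvgM; first exact: cvgV (oner_neq0 _) W1.
apply: (@cvg_mulmx_entry _ _ _ _ _ _ _
  (fun z => invmx (S t) *m ((z - t)^-1 *: (A z - A t))) S); last exact: S_t.
move=> i j; apply: (@cvg_mulmx_entry _ _ _ _ _ _ _ (fun=> invmx (S t))
  (fun z => (z - t)^-1 *: (A z - A t))) => i' j'; first exact: cvg_cst.
exact: cvg_difference_quotient_entry (dA Pt).
Qed.

Lemma S_bounded i j : exists M : R, forall t, P t -> rnorm (S t i j) <= M.
Proof. by apply: rnorm_bounded_within => // t Pt; exact: cvg_entry. Qed.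

Lemma invmx_S_bounded i j :
  exists M : R, forall t, P t -> rnorm (invmx (S t) i j) <= M.
Proof. by apply: rnorm_bounded_within => // t Pt; exact: cvg_invmx_S. Qed.

Lemma coord_bounded j :
  exists M : R, forall t, P t -> rnorm ((invmx (S t) *m f t) j 0) <= M.
Proof.
apply: rnorm_bounded_within => // t Pt; apply: cvg_mulmx_entry => i i'.
  exact: cvg_invmx_S.
exact: cvg_entry.
Qed.

(** The images are disjoint compact intervals, hence at positive distance [e]. *)
Lemma lam_gap j k : j != k ->
  exists M : R, forall t t', P t -> P t' -> rnorm (lam j t' - lam k t)^-1 <= M.
Proof.
move=> jk.
have [e e0 gap] : exists2 e : R, 0 < e & forall x y, x \in `[lo j, hi j] ->
    y \in `[lo k, hi k] -> e <= `|x - y|.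
  have [h1|h1] := ltP (hi k) (lo j).
    exists (lo j - hi k); first by rewrite subr_gt0.
    move=> x y; rewrite !in_itv /= => /andP[? ?] /andP[? ?].
    by apply: le_trans (ler_norm _); lra.
  have [h2|h2] := ltP (hi j) (lo k).
    exists (lo k - hi j); first by rewrite subr_gt0.
    move=> x y; rewrite !in_itv /= => /andP[? ?] /andP[? ?].
    by rewrite distrC; apply: le_trans (ler_norm _); lra.
  exfalso; have lhj := lo_lt_hi P2 lam_inj lamP j.
  have lhk := lo_lt_hi P2 lam_inj lamP k.
  have inI i x : lo i <= x -> x <= hi i -> (lam i @` P) x%:C.
    by move=> l h; rewrite lamP; exists x => //=; rewrite in_itv /= l h.
  (* If neither interval lies to the left of the other, the larger left endpoint belongs to both. *)
  pose x := Num.max (lo j) (lo k).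
  have [t Pt jt] : (lam j @` P) x%:C.
    by apply: inI; rewrite ?le_max ?lexx // ge_max h2 ltW.
  have [t' Pt' kt] : (lam k @` P) x%:C.
    by apply: inI; rewrite ?le_max ?lexx ?orbT // ge_max h1 ltW.
  have [/eqP] : j = k /\ t = t' by apply: lam_inj => //; rewrite jt kt.
  by rewrite (negPf jk).
exists e^-1 => t t' Pt Pt'.
have [x xI ->] := lam_lohi lamP k Pt; have [y yI ->] := lam_lohi lamP j Pt'.
rewrite -rmorphB -fmorphV rnorm_real normfV lef_pV2 ?posrE ?gap //.
by rewrite (lt_le_trans e0) ?gap.
Qed.

Section FixedIndex.
Variable k : 'I_n.
Hypothesis dlam_neq0 : forall t, P t -> dlam k t != 0.
Local Notation dominated := (increment_dominated P (lam k)).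

Let lamk_cont t : P t -> lam k @ within P (nbhs t) --> lam k t.
Proof. by move: t; exact/subspace_continuousP/lam_cont. Qed.

Let lamk_inj t t' : P t -> P t' -> lam k t = lam k t' -> t = t'.
Proof. by move=> Pt Pt' /(lam_inj Pt Pt') []. Qed.

Lemma entry_dominated m p (h h' : cplx R -> 'M[cplx R]_(m, p)) i j :
  {within P, continuous h'} -> (forall t, P t -> derive_within P h t (h' t)) ->
  dominated (fun t t' => (h t' - h t) i j).
Proof.
move=> h'c dh.
apply: (@increment_dominated_eq _ _ _ _ (fun t t' => h t' i j - h t i j)).
  by move=> t t' _ _; rewrite !mxE.
apply: (@increment_dominated_deriv _ _ _ _ _ cP lamk_cont lamk_inj (lamP k)
  (fun t => h t i j) (fun t => h' t i j) (dlam k)).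
- by move=> t Pt; exact/derive_within_entry/dh.
- by move=> t Pt; exact: cvg_entry.
- exact: derive_within_lam.
- exact: dlam_cont.
- exact: dlam_neq0.
Qed.

Lemma id_dominated : dominated (fun t t' => t' - t).
Proof.
apply: (@increment_dominated_deriv _ _ _ _ _ cP lamk_cont lamk_inj (lamP k)
  id (fun=> 1) (dlam k)).
- move=> t Pt; rewrite /derive_within; apply: cvg_near_cst.
  rewrite near_withinE /dnbhs near_withinE; apply: nearW => z zt _.
  by rewrite [LHS]mulVf // subr_eq0.
- by move=> t Pt; exact: cvg_cst.
- exact: derive_within_lam.
- exact: dlam_cont.
- exact: dlam_neq0.
Qed.

Lemma f_dominated i : dominated (fun t t' => (f t' - f t) i 0).
Proof.
have [L L0 fL] := f_lip.
apply: (@increment_dominated_eq _ _ _ _ (fun t t' => f t' i 0 - f t i 0)).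
  by move=> t t' _ _; rewrite !mxE.
apply: (@increment_dominated_lip R P (lam k) (fun t => f t i 0) L);
  [|exact: ltW|exact: id_dominated].
move=> t t' Pt Pt'.
have -> : f t' i 0 - f t i 0 = (f t' - f t) i 0 by rewrite !mxE.
apply: le_trans (rnorm_coord_le _ _ _) _.
have := fL (t', t) (conj Pt' Pt).
by rewrite /= [X in _ <= _ * X]normr_rnorm -rmorphM rnorm_le.
Qed.

Lemma invmx_S_mul_dominated (h : cplx R -> cplx R -> 'cV[cplx R]_n) :
  (forall i, dominated (fun t t' => h t t' i 0)) ->
  dominated (fun t t' => (invmx (S t) *m h t t') k 0).
Proof.
move=> hD.
apply: (@increment_dominated_eq _ _ _ _
  (fun t t' => \sum_i invmx (S t) k i * h t t' i 0)).
  by move=> t t' _ _; rewrite mxE.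
apply: increment_dominated_sum => i _; apply: increment_dominatedM => //.
by have [M SM] := invmx_S_bounded k i; exists M => t t' Pt _; exact: SM.
Qed.

Lemma eigenbasis_change_dominated j :
  dominated (fun t t' => (invmx (S t) *m S t') k j - (k == j)%:R).
Proof.
have off i : i != k -> dominated (fun t t' => (invmx (S t) *m S t') k i - (k == i)%:R).
  move=> ik.
  (* The identity is solved for the off-diagonal entry and expanded, so that every term is a bounded
     factor times an increment of [A]. *)
  apply: (@increment_dominated_eq _ _ _ _ (fun t t' => (lam i t' - lam k t)^-1 *
     \sum_c S t' c i * (invmx (S t) *m col c (A t' - A t)) k 0)).
    move=> t t' Pt Pt'; rewrite eq_sym (negPf ik) subr0.
    have : lam i t' - lam k t != 0.
      by rewrite subr_eq0; apply: contraNneq ik => /(lam_inj Pt' Pt) [->].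
    move=> g0; apply: (mulfI g0); rewrite mulVKf // mulrC.
    rewrite (eigenbasis_change (uS Pt) (uS Pt') (AS Pt) (AS Pt')) mxE.
    apply: eq_bigr => c _; rewrite mulrC; congr (_ * _); rewrite !mxE.
    by apply: eq_bigr => a _; rewrite !mxE.
  apply: increment_dominatedM; first exact: lam_gap.
  apply: increment_dominated_sum => c _; apply: increment_dominatedM.
    by have [M SM] := S_bounded c i; exists M => t t' _ Pt'; exact: SM.
  apply: invmx_S_mul_dominated => a.
  apply: increment_dominated_eq (entry_dominated a c A'_cont dA).
  by move=> t t' _ _; rewrite !mxE.
have [/eqP ->|/off //] := boolP (j == k).
(* The diagonal entry is the row sum, an increment of [b], minus the off-diagonal entries. *)
apply: (@increment_dominated_eq _ _ _ _ (fun t t' => (invmx (S t) *m (b t' - b t)) k 0 -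
   \sum_(i | i != k) ((invmx (S t) *m S t') k i - (k == i)%:R))).
  move=> t t' Pt Pt'.
  rewrite -(eigenbasis_change_row_sum (uS Pt') k (bS Pt) (bS Pt')).
  by rewrite [in RHS](bigD1 k) //= addrK eqxx.
apply: increment_dominatedB; last exact: increment_dominated_sum.
by apply: invmx_S_mul_dominated => i; exact: entry_dominated b'_cont db.
Qed.

Lemma coord_pullback_lip : lip_on (lam k @` P) (coord_pullback P S f (lam k) k).
Proof.
have [C gC] : dominated
    (fun t t' => (invmx (S t') *m f t') k 0 - (invmx (S t) *m f t) k 0).
  apply: (@increment_dominated_eq _ _ _ _ (fun t t' =>
    (invmx (S t) *m (f t' - f t)) k 0 -
    \sum_j (invmx (S t') *m f t') j 0 * ((invmx (S t) *m S t') k j - (k == j)%:R))).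
    move=> t t' Pt Pt'; rewrite (eigenbasis_change_coord (S t) (uS Pt')).
    by congr (_ - _); apply: eq_bigr => j _; rewrite mulrC.
  apply: increment_dominatedB.
    by apply: invmx_S_mul_dominated => i; exact: f_dominated.
  apply: increment_dominated_sum => j _; apply: increment_dominatedM.
    by have [M fM] := coord_bounded j; exists M => t t' _ Pt'; exact: fM.
  exact: eigenbasis_change_dominated.
exists (`|C| + 1); first by rewrite ltr_pwDr.
move=> [_ _] [/= [t' Pt' <-] [t Pt <-]].
rewrite !(coord_pullback_lam S f lam_inj) //.
rewrite [X in _ <= _ * X]normr_rnorm -rmorphM rnorm_le.
apply: le_trans (gC t t' Pt Pt') _; apply: ler_wpM2r; first exact: rnorm_ge0.
by rewrite (le_trans (ler_norm C)) // lerDl.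
Qed.

End FixedIndex.
End C1Case.

Theorem theorem10 (R : realType) (n : nat) (P : set (cplx R))
    (A : cplx R -> 'M[cplx R]_n) (b : cplx R -> 'cV[cplx R]_n)
    (lam : 'I_n -> cplx R -> cplx R) (S : cplx R -> 'M[cplx R]_n)
    (normM : 'M[cplx R]_n -> R) (f : cplx R -> 'cV[cplx R]_n)
    (lo hi : 'I_n -> R) :
  (0 < n)%N ->
  jordan_arc P ->
  {within P, continuous A} ->
  {within P, continuous b} ->
  (* N1 *)
  (forall t, P t -> reachable (A t) (b t)) ->
  (* N2 *)
  (forall t t', P t -> P t' -> t <> t' ->
    spectrum (A t) `&` spectrum (A t') = set0) ->
  (* S2 *)
  (forall t, P t -> simple_eigenvalues (A t)) ->
  (* the eigenvalue functions and the change of coordinates *)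
  (forall k, {within P, continuous (lam k)}) ->
  {within P, continuous S} ->
  (forall t, P t -> S t \in unitmx) ->
  (forall t, P t ->
    invmx (S t) *m A t *m S t = diag_mx (\row_k lam k t)) ->
  (forall t, P t -> invmx (S t) *m b t = const_mx 1) ->
  (* the matrix norm *)
  is_norm normM ->
  (forall (X : 'M[cplx R]_n) (v : 'cV[cplx R]_n),
    rnorm (X *m v) <= normM X * rnorm v) ->
  {within P, continuous f} ->
  (forall k, lam k @` P = [set (x%:C : cplx R) | x in `[lo k, hi k]]) ->
  let g (k : 'I_n) := coord_pullback P S f (lam k) k in
  let result : Prop :=
    forall (eps : R) (L : 'I_n -> R) (m : 'I_n -> nat)
      (q : 'I_n -> {poly cplx R}) (N : nat) (beta : nat -> cplx R),
    let normS := sup [set normM (S t) | t in P] in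
    let M k := supnorm (lam k @` P) (g k) in
    let B k := bernstein (lo k) (hi k) (g k) (m k) in
    let alpha k l := supnorm P (fun t => (B l).[lam k t]) in
    0 < eps ->
    (forall k, 0 < L k) ->
    (forall k, ((L k)%:C).-lipschitz_(lam k @` P) (g k)) ->
    (forall k, (3 <= m k)%N) ->
    (forall k,
      Num.sqrt 2 * (4 * M k + (hi k - lo k) * L k / 2)
        * Num.sqrt (ln (m k)%:R / (m k)%:R) < eps / (3 * normS)) ->
    (* the right-hand side is +oo when the sum of the alpha k l is 0 *)
    (forall j k, 0 < \sum_l alpha k l ->
      supnorm (lam k @` P) (fun z => (q j).[z] - \1_(lam j @` P) z)
        < eps / (3 * normS * \sum_l alpha k l)) ->
    \sum_k q k * B k = \sum_(l < N.+1) beta l *: 'X^l ->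
    supnorm P (fun t =>
      solution A b N.+1 (fun i => beta (N - i)%N) (fun=> 0) t - f t) < eps in
  ((forall k, lip_on (lam k @` P) (g k)) -> result)
  /\
  (C1_on P A -> C1_on P b -> lip_on P f ->
    result /\
    forall k, (forall t d, P t -> derive_within P (lam k) t d -> d <> 0) ->
      lip_on (lam k @` P) (g k)).
Proof.
move=> n0 jP _ _ _ N2 S2 lam_cont S_cont uS AS bS _ normMv f_cont lamP g result.
have cP := jordan_arc_compact jP; have P2 := jordan_arc_two_points jP.
(* Disjointness of the spectra identifies the parameters, and simplicity of the eigenvalues then
   identifies the indices. *)
have lam_inj j k t t' : P t -> P t' -> lam j t = lam k t' -> j = k /\ t = t'.
  move=> Pt Pt' e; have tt' : t = t'.
    apply: contrapT => ne; have := N2 t t' Pt Pt' ne.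
    apply/eqP/set0P; exists (lam j t); split.
      exact: (spectrum_diagonalized (uS t Pt) (AS t Pt) j).
    by rewrite e; exact: (spectrum_diagonalized (uS t' Pt') (AS t' Pt') k).
  split=> //; rewrite -tt' in e.
  exact: (diagonalized_inj (uS t Pt) (AS t Pt) (S2 t Pt)) e.
(* [result] carries the Lipschitz constants [L] itself, so one estimate serves both cases; the $C^1$
   case adds the Lipschitz property of [g]. *)
have res : result.
  move=> eps L m q N beta normS M B alpha eps0 L0 gL m3 mB qB pE.
  exact: (approximation P2 lam_inj uS AS bS normMv lamP n0 eps0 L0 gL m3 mB qB pE).
split=> [_|[A' A'c dA] [b' b'c db] f_lip]; first exact: res.
split=> [|k dk]; first exact: res.
apply: (coord_pullback_lip cP P2 lam_inj lam_cont S_cont uS AS bS lamP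
  A'c dA b'c db f_cont f_lip) => t Pt.
apply/eqP; apply: (dk t _ Pt).
exact: (derive_within_lam S_cont uS AS dA Pt).
Qed.
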